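(* Let $M=\mathbb{R}^k$ be a $k$-dimensional Euclidean space. The symmetry defect function $\mu:\mathrm{Conf}_n(\mathbb{R}^k)\to\mathbb{R}$ is continuous with respect to the configuration $X$.
   Context: Fix $n\geq 2$ and $p\geq 1$. $\mathrm{Conf}_n(\mathbb{R}^k)$ is the space of unordered configurations (subsets of $n$ distinct points) of $\mathbb{R}^k$ with its usual topology. For $X\in\mathrm{Conf}_n(\mathbb{R}^k)$ and an isometry $\pi\in\mathrm{Iso}(\mathbb{R}^k)$, the symmetry defect of $X$ with respect to $\pi$ is $$\mu(X,\pi)=\Big(\inf_{\gamma\neq\pi|_X}\sum_{x\in X}\|x-\gamma(x)\|^p\Big)^{1/p},$$ the infimum being over all bijections $\gamma:X\to\pi(X)$ other than the restriction $\pi|_X$. The symmetry defect of $X$ is $\mu(X)=\inf_{\pi\in\mathrm{Iso}(\mathbb{R}^k)}\mu(X,\pi)$. *)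

(* Defs.v *)
From HB Require Import structures.
From mathcomp Require Import all_boot all_order all_algebra generic_quotient.
From mathcomp Require Import all_classical all_reals all_analysis.

Set Implicit Arguments.
Unset Strict Implicit.
Unset Printing Implicit Defensive.

Import Order.TTheory GRing.Theory Num.Theory.
Import numFieldNormedType.Exports.

Local Open Scope classical_set_scope.
Local Open Scope card_scope.
Local Open Scope ring_scope.

(* The library's norm `|v| on row vectors is the sup norm; it induces the same
   topology as the Euclidean norm below. *)
Definition enorm (R : realType) (k : nat) (v : 'rV[R]_k) : R :=
  Num.sqrt (\sum_(i < k) v ord0 i ^+ 2).

Definition Iso (R : realType) (k : nat) : set ('rV[R]_k -> 'rV[R]_k) :=
  [set f | bijective f /\ forall u v, enorm (f u - f v) = enorm (u - v)].

(* [oconf]: ordered configurations, as a subspace of the product space (R^k)^n.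
   [conf]: unordered ones, as a quotient of [oconf]. *)
Definition oconf (R : realType) (k n : nat) :=
  set_type [set x : {ptws 'I_n -> 'rV[R]_k} | injective x].

HB.instance Definition _ (R : realType) (k n : nat) :=
  Topological.copy (oconf R k n)
    (set_type [set x : {ptws 'I_n -> 'rV[R]_k} | injective x]).

Definition conf (R : realType) (k n : nat) :=
  set_type [set X : set 'rV[R]_k | X #= `I_n].

Definition points (R : realType) (k n : nat) (X : conf R k n) : set 'rV[R]_k :=
  set_val X.

Lemma card_range_oconf (R : realType) (k n : nat) (x : oconf R k n) :
  range (set_val x) \in [set X : set 'rV[R]_k | X #= `I_n].
Proof.
apply/mem_set => /=; have /set_mem xinj := valP x.
have hc : range (set_val x) #= [set: 'I_n] by apply: inj_card_eq => i j _ _ /xinj.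
by apply: card_eq_trans hc _; rewrite card_eq_sym; exact: card_II.
Qed.

Definition forget_order (R : realType) (k n : nat) (x : oconf R k n) :
  conf R k n := exist _ (range (set_val x)) (card_range_oconf x).

Lemma forget_order_surj (R : realType) (k n : nat) (X : conf R k n) :
  exists x : oconf R k n, forget_order x = X.
Proof.
have /set_mem /= Xn := valP X.
have /card_esym /card_set_bijP[f [fX finj fsurj]] : val X #= [set: 'I_n].
  by apply: card_eq_trans Xn _; exact: card_II.
have finj' : f \in [set x : {ptws 'I_n -> 'rV[R]_k} | injective x].
  by apply/mem_set => /= i j fij; apply: finj => //; rewrite inE.
exists (exist _ f finj'); apply: val_inj => /=.
by apply/seteqP; split => [_ [i _ <-]|v /fsurj]; first exact: fX.
Qed.

Definition order_points (R : realType) (k n : nat) (X : conf R k n) :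
  oconf R k n := projT1 (cid (forget_order_surj X)).

Lemma order_pointsK (R : realType) (k n : nat) :
  cancel (@order_points R k n) (@forget_order R k n).
Proof. by move=> X; exact: projT2 (cid (forget_order_surj X)). Qed.

HB.instance Definition _ (R : realType) (k n : nat) :=
  isQuotient.Build (oconf R k n) (conf R k n) (@order_pointsK R k n).

(* The quotient topology by the action of the symmetric group: a set of
   unordered configurations is open iff its preimage under [forget_order] is. *)
HB.instance Definition _ (R : realType) (k n : nat) :=
  Topological.copy (conf R k n) (quotient_topology (conf R k n)).

(* Bijections from X to pi(X) are represented by total maps g of R^k, of which
   only the restriction to X matters. *)
Definition defect_wrt (R : realType) (k n : nat) (p : R) (X : conf R k n)
    (pi : 'rV[R]_k -> 'rV[R]_k) : R :=
  inf [set \sum_(x \in points X) enorm (x - g x) `^ p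
      | g in [set g | set_bij (points X) (pi @` points X) g
                      /\ ~ {in points X, g =1 pi}]] `^ p^-1.

Definition symmetry_defect (R : realType) (k n : nat) (p : R)
    (X : conf R k n) : R :=
  inf [set defect_wrt p X pi | pi in @Iso R k].

(* Main.v *)
Require Import Defs.
From mathcomp Require Import all_boot all_order all_fingroup all_algebra.
From mathcomp Require Import all_classical all_reals all_analysis.

Set Implicit Arguments.
Unset Strict Implicit.
Unset Printing Implicit Defensive.

Import Order.TTheory GRing.Theory Num.Theory.
Import numFieldNormedType.Exports.

Local Open Scope classical_set_scope.
Local Open Scope ring_scope.

(** The symmetry defect is 2-Lipschitz, and this yields continuity without any
    compactness of the isometry group.

    Once the points of a configuration are ordered as x_1, ..., x_n, a
    bijection from X to pi(X) is the same thing as a permutation s, through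
    x_i |-> pi(x_(s i)), and it differs from the restriction of pi exactly
    when s is not the identity. Hence mu(X) is the infimum, over isometries pi
    and permutations s <> 1, of the l^p norm of the vector of distances
    |x_i - pi(x_(s i))|. Fix pi and s, and move x to another ordered
    configuration y. For each i, as pi is an isometry,
      |y_i - pi(y_(s i))|
        <= |y_i - x_i| + |x_i - pi(x_(s i))| + |x_(s i) - y_(s i)|,
    so by Minkowski's inequality the l^p norm increases by at most 2 d(x, y),
    where d is the l^p distance; the last term contributes d(x, y) again
    because s merely permutes the coordinates. The bound does not depend on pi
    and s, so it survives the infima and
      mu(Y) <= mu(X) + 2 d(x, y)
    (symmetry_defect_lipschitz). Exchanging x and y gives the reverse bound.
    As d(x, y) tends to 0 when y tends to x in the product topology, mu is
    continuous on ordered configurations, hence on their quotient. *)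

(** * Minkowski's inequality for finite families *)

(** The l^p norm on families of nonnegative reals; absolute values are left
    out because all the families below are families of distances. *)
Definition pnorm {R : realType} {I : finType} (p : R) (a : I -> R) : R :=
  (\sum_i a i `^ p) `^ p^-1.

Section Pnorm.
Context {R : realType} {I : finType} (p : R).
Hypothesis p1 : 1 <= p.
Implicit Types a b : I -> R.

Let p_gt0 : 0 < p. Proof. exact: lt_le_trans p1. Qed.

Lemma pnorm_ge0 a : 0 <= pnorm p a.
Proof. exact: powR_ge0. Qed.

Lemma sum_powR_ge0 a : 0 <= \sum_i a i `^ p.
Proof. by apply: sumr_ge0 => i _; exact: powR_ge0. Qed.

Lemma powR_pnorm a : pnorm p a `^ p = \sum_i a i `^ p.
Proof. by rewrite -powRrM mulVf ?gt_eqF// powRr1// sum_powR_ge0. Qed.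

Lemma le_pnorm a b : (forall i, 0 <= a i) -> (forall i, a i <= b i) ->
  pnorm p a <= pnorm p b.
Proof.
move=> a0 ab; rewrite ge0_ler_powR ?nnegrE ?sum_powR_ge0 ?invr_ge0 ?(ltW p_gt0)//.
apply: ler_sum => i _; rewrite ge0_ler_powR ?nnegrE ?(ltW p_gt0)//.
exact: le_trans (ab i).
Qed.

Lemma pnormZ (c : R) a : 0 <= c -> (forall i, 0 <= a i) ->
  pnorm p (fun i => c * a i) = c * pnorm p a.
Proof.
move=> c0 a0; rewrite /pnorm.
under eq_bigr do rewrite powRM//.
rewrite -mulr_sumr powRM ?powR_ge0 ?sum_powR_ge0//.
by rewrite -powRrM mulfV ?gt_eqF// powRr1.
Qed.

Lemma pnorm0_eq0 a : (forall i, 0 <= a i) -> pnorm p a = 0 -> forall i, a i = 0.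
Proof.
move=> a0 /eqP; rewrite powR_eq0 => /andP[/eqP sum0 _] i.
have /(_ i isT)/eqP := psumr_eq0P (fun i _ => powR_ge0 (a i) p) sum0.
by rewrite powR_eq0 => /andP[/eqP].
Qed.

(** Convexity of t |-> t^p at the barycentre
    (x + y) / (A + B) = A / (A + B) * (x / A) + B / (A + B) * (y / B). The
    weights are chosen so that the bound sums to (A + B)^p when A and B are the
    norms of the two families that x and y come from. *)
Lemma powRD_convex (A B x y : R) : 0 < A -> 0 < B -> 0 <= x -> 0 <= y ->
  (x + y) `^ p <= (A + B) `^ p *
    (A / (A + B) * (x `^ p / A `^ p) + B / (A + B) * (y `^ p / B `^ p)).
Proof.
move=> A0 B0 x0 y0; have AB0 : 0 < A + B by rewrite addr_gt0.
have t0 : 0 <= A / (A + B) by rewrite divr_ge0 ?ltW.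
have t1 : A / (A + B) <= 1 by rewrite ler_pdivrMr// mul1r lerDl ltW.
have in0 (z : R) : 0 <= z -> z \in (`[0, +oo[%classic : set R).
  by move=> z0; rewrite inE /= in_itv /= z0.
have := @convex_powR R p p1 (Itv01 t0 t1) (x / A) (y / B)
  (in0 _ (divr_ge0 x0 (ltW A0))) (in0 _ (divr_ge0 y0 (ltW B0))).
rewrite convRE [X in X `^ _ <= _ -> _]convRE /= /unstable.onem.
have -> : 1 - A / (A + B) = B / (A + B).
  by rewrite -[X in X - _](divff (lt0r_neq0 AB0)) -mulrBl addrC addKr.
have xy : x + y = (A + B) * (A / (A + B) * (x / A) + B / (A + B) * (y / B)).
  have cancel (C z : R) : 0 < C -> (A + B) * (C / (A + B) * (z / C)) = z.
    move=> C0; rewrite mulrA [_ * (C / _)]mulrC divfK ?gt_eqF//.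
    by rewrite mulrC divfK ?gt_eqF.
  by rewrite mulrDr !cancel.
have div_powR (z C : R) : 0 <= z -> 0 < C -> (z / C) `^ p = z `^ p / C `^ p.
  move=> z0 C0; apply: (mulIf (lt0r_neq0 (powR_gt0 p C0))).
  rewrite [RHS]divfK ?gt_eqF ?powR_gt0//.
  by rewrite -powRM ?divr_ge0 ?(ltW C0)// divfK ?gt_eqF.
rewrite !div_powR// => convex.
rewrite xy powRM ?(ltW AB0)//; first by rewrite ler_pM2l ?powR_gt0.
by rewrite addr_ge0 ?mulr_ge0 ?invr_ge0 ?(ltW A0) ?(ltW B0) ?(ltW AB0).
Qed.

Lemma sum_powRD (A B : R) a b : 0 < A -> 0 < B ->
  (forall i, 0 <= a i) -> (forall i, 0 <= b i) ->
  \sum_i a i `^ p = A `^ p -> \sum_i b i `^ p = B `^ p ->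
  \sum_i (a i + b i) `^ p <= (A + B) `^ p.
Proof.
move=> A0 B0 a0 b0 sumA sumB.
have normalized (c C : R) (f : I -> R) : 0 < C -> \sum_i f i `^ p = C `^ p ->
    \sum_i c * (f i `^ p / C `^ p) = c.
  move=> C0 fC; rewrite -mulr_sumr -mulr_suml fC divff ?mulr1//.
  exact: lt0r_neq0 (powR_gt0 _ C0).
have AB0 := addr_gt0 A0 B0.
apply: le_trans (ler_sum _ (fun i _ => powRD_convex A0 B0 (a0 i) (b0 i))) _.
rewrite -mulr_sumr big_split /= (normalized _ _ _ A0 sumA) (normalized _ _ _ B0 sumB).
by rewrite -mulrDl divff ?mulr1// lt0r_neq0.
Qed.

Lemma pnormD a b : (forall i, 0 <= a i) -> (forall i, 0 <= b i) ->
  pnorm p (fun i => a i + b i) <= pnorm p a + pnorm p b.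
Proof.
move=> a0 b0.
(* The normalization by the two norms needs them to be nonzero. *)
have [A0|A0] := eqVneq (pnorm p a) 0.
  rewrite A0 add0r le_pnorm// => i; first by rewrite addr_ge0.
  by rewrite (pnorm0_eq0 a0 A0) add0r.
have [B0|B0] := eqVneq (pnorm p b) 0.
  rewrite B0 addr0 le_pnorm// => i; first by rewrite addr_ge0.
  by rewrite (pnorm0_eq0 b0 B0) addr0.
have {}A0 : 0 < pnorm p a by rewrite lt_neqAle eq_sym A0 pnorm_ge0.
have {}B0 : 0 < pnorm p b by rewrite lt_neqAle eq_sym B0 pnorm_ge0.
have AB0 := addr_gt0 A0 B0.
rewrite -[leRHS]powRr1 ?(ltW AB0)// -(mulfV (lt0r_neq0 p_gt0)) powRrM.
rewrite ge0_ler_powR ?nnegrE ?invr_ge0 ?(ltW p_gt0) ?sum_powR_ge0 ?powR_ge0//.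
by apply: sum_powRD => //; rewrite powR_pnorm.
Qed.

Lemma pnorm_perm (s : {perm I}) a : pnorm p (fun i => a (s i)) = pnorm p a.
Proof. by rewrite /pnorm [in RHS](reindex_inj (@perm_inj _ s)). Qed.

End Pnorm.

(** * The Euclidean norm *)

Section Enorm.
Context {R : realType} {k : nat}.
Implicit Types u v : 'rV[R]_k.

Lemma enorm_ge0 u : 0 <= enorm u.
Proof. exact: sqrtr_ge0. Qed.

(** Seen as an l^2 norm, the Euclidean norm inherits its triangle inequality
    from Minkowski's. *)
Lemma enormE u : enorm u = pnorm 2 (fun i => `|u ord0 i|).
Proof.
rewrite /enorm /pnorm -powR12_sqrt; last by apply: sumr_ge0 => i _; rewrite sqr_ge0.
by under [in RHS]eq_bigr do rewrite powR_mulrn// real_normK ?num_real//.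
Qed.

Lemma enormN u : enorm (- u) = enorm u.
Proof. by rewrite !enormE; congr pnorm; apply/funext => i; rewrite mxE normrN. Qed.

Lemma enormD u v : enorm (u + v) <= enorm u + enorm v.
Proof.
have two1 : 1 <= 2 :> R by rewrite ler1n.
rewrite !enormE; apply: le_trans (pnormD two1 _ _) => //.
by apply: le_pnorm => // i; rewrite mxE ler_normD.
Qed.

(** This is how the topology, which comes from the sup norm, controls
    Euclidean distances. *)
Lemma enorm_le_norm u : enorm u <= pnorm 2 (fun=> 1 : R) (I := 'I_k) * `|u|.
Proof.
have two1 : 1 <= 2 :> R by rewrite ler1n.
rewrite enormE mulrC -(pnormZ two1 (normr_ge0 u) (fun=> ler01)).
apply: le_pnorm => // i.
rewrite mulr1 /Num.norm /= mx_normrE.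
exact: (le_bigmax _ (fun j : 'I_1 * 'I_k => `|u j.1 j.2|) (ord0, i)).
Qed.

End Enorm.

(** * Bijections onto the image as permutations *)

Section Displacement.
Context {R : realType} {k n : nat}.
Implicit Types (x y : oconf R k n)
  (pi : 'rV[R]_k -> 'rV[R]_k) (s : {perm 'I_n}).

Lemma oconf_inj x : injective (set_val x).
Proof. exact: set_mem (valP x). Qed.

Lemma Iso_inj pi : @Iso R k pi -> injective pi.
Proof. by case=> /bij_inj. Qed.

Definition displacement (p : R) x pi s : R :=
  pnorm p (fun i => enorm (set_val x i - pi (set_val x (s i)))).

Lemma sum_points x (F : 'rV[R]_k -> R) :
  \sum_(v \in points (forget_order x)) F v = \sum_i F (set_val x i).
Proof.
rewrite /points /= fsbig_image; last by move=> i j _ _ /oconf_inj.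
rewrite (fsbigE (index_enum 'I_n)) ?index_enum_uniq//; last first.
  by move=> i _; rewrite mem_index_enum.
apply: eq_bigl => i; exact: mem_set.
Qed.

Lemma perm_of_bij x pi g :
  set_bij (points (forget_order x)) (pi @` points (forget_order x)) g ->
  exists s, forall i, g (set_val x i) = pi (set_val x (s i)).
Proof.
move=> [gfun ginj _].
have /choice[f fE] (i : 'I_n) : exists j, g (set_val x i) = pi (set_val x j).
  by have [_ [j _ <-] <-] := gfun _ (imageT (set_val x) i); exists j.
suff finj : injective f by exists (perm finj) => i; rewrite permE.
move=> i j fij; apply/(@oconf_inj x)/ginj; try exact/mem_set/imageT.
by rewrite !fE fij.
Qed.

Lemma bij_of_perm x pi s : @Iso R k pi ->
  exists2 g, set_bij (points (forget_order x)) (pi @` points (forget_order x)) g &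
    forall i, g (set_val x i) = pi (set_val x (s i)).
Proof.
move=> /Iso_inj pi_inj.
pose g v := if [pick i | set_val x i == v] is Some i
            then pi (set_val x (s i)) else v.
have gE i : g (set_val x i) = pi (set_val x (s i)).
  rewrite /g; case: pickP => [j /eqP/oconf_inj -> //|/(_ i)].
  by rewrite eqxx.
exists g => //; split.
- move=> _ [i _ <-]; rewrite gE; exists (set_val x (s i)) => //.
  exact: imageT.
- by move=> _ _ /set_mem[i _ <-] /set_mem[j _ <-]; rewrite !gE => /pi_inj/oconf_inj/perm_inj ->.
- move=> _ [_ [i _ <-] <-]; exists (set_val x (s^-1%g i)); first exact: imageT.
  by rewrite gE permKV.
Qed.

(** Ordering the points turns the infimum over maps of the whole space into one
    over a set of permutations that does not depend on the configuration, so
    that two configurations can be compared. *)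
Lemma defect_wrtE p x pi : @Iso R k pi ->
  defect_wrt p (forget_order x) pi =
  inf [set \sum_i enorm (set_val x i - pi (set_val x (s i))) `^ p
      | s in [set s : {perm 'I_n} | s != 1%g]] `^ p^-1.
Proof.
move=> piI; rewrite /defect_wrt; congr (inf _ `^ _); apply/seteqP; split.
- move=> _ [g [gbij gpi] <-]; have [s gE] := perm_of_bij gbij.
  exists s; last by rewrite sum_points; apply: eq_bigr => i _; rewrite gE.
  apply/eqP => s1; apply: gpi => _ /set_mem[i _ <-].
  by rewrite gE s1 perm1.
- move=> _ [s /= s1 <-]; have [g gbij gE] := bij_of_perm x s piI.
  exists g; last by rewrite sum_points; apply: eq_bigr => i _; rewrite gE.
  split=> // gpi; case/negP: s1; apply/eqP/permP => i.
  apply/(@oconf_inj x)/(Iso_inj piI); rewrite perm1 -gE gpi//.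
  by apply/mem_set; exact: imageT.
Qed.

(** * Lipschitz bound *)

Variable p : R.
Hypothesis p1 : 1 <= p.

Let p_gt0 : 0 < p. Proof. exact: lt_le_trans p1. Qed.

Lemma has_lbound_cost x pi (S : set {perm 'I_n}) :
  has_lbound [set \sum_i enorm (set_val x i - pi (set_val x (s i))) `^ p
             | s in S].
Proof. by exists 0 => _ [s _ <-]; exact: sum_powR_ge0. Qed.

Lemma defect_wrt_le x pi s : @Iso R k pi -> s != 1%g ->
  defect_wrt p (forget_order x) pi <= displacement p x pi s.
Proof.
move=> piI s1; rewrite defect_wrtE//.
rewrite ge0_ler_powR ?nnegrE ?invr_ge0 ?(ltW p_gt0) ?sum_powR_ge0//.
  by apply: lb_le_inf => [|_ [r _ <-]]; [eexists; exists s|exact: sum_powR_ge0].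
by apply: ge_inf; [exact: has_lbound_cost|exists s].
Qed.

(** The infimum of the empty set is 0, so a permutation can be extracted only if
    there is one other than the identity: this is where two points are
    needed. *)
Lemma defect_wrt_lt x pi (c : R) : (2 <= n)%N -> @Iso R k pi ->
  defect_wrt p (forget_order x) pi < c ->
  exists2 s, s != 1%g & displacement p x pi s <= c.
Proof.
move=> n2 piI; rewrite defect_wrtE//; set S := [set _ | _ in _] => ltc.
have c0 : 0 < c by exact: le_lt_trans (powR_ge0 _ _) ltc.
have cE : (c `^ p) `^ p^-1 = c by rewrite -powRrM mulfV ?gt_eqF// powRr1 ?ltW.
have S0 : S !=set0.
  pose i0 : 'I_n := Ordinal (ltnW n2); pose i1 : 'I_n := Ordinal n2.
  eexists; exists (tperm i0 i1) => //=.
  by apply/eqP => /permP/(_ i0); rewrite tpermL perm1.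
have /inf_lt[//|_ [s s1 <-] sc] : inf S < c `^ p.
  rewrite ltNge; apply: contraL ltc => cS; rewrite -leNgt -{1}cE.
  rewrite ge0_ler_powR ?nnegrE ?invr_ge0 ?(ltW p_gt0) ?powR_ge0//.
  exact: le_trans (powR_ge0 _ _) cS.
exists s => //; rewrite -cE.
by rewrite ge0_ler_powR ?nnegrE ?invr_ge0 ?(ltW p_gt0) ?powR_ge0 ?sum_powR_ge0 ?ltW.
Qed.

(** The distance depends on the orderings. This is harmless: the bound on
    unordered configurations below holds for every choice of orderings. *)
Definition config_dist x y : R :=
  pnorm p (fun i => enorm (set_val x i - set_val y i)).

Lemma config_distC x y : config_dist x y = config_dist y x.
Proof. by congr pnorm; apply/funext => i; rewrite -enormN opprB. Qed.

(** The constant does not depend on the isometry: x_(s i) and y_(s i) are as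
    far apart before as after applying it. *)
Lemma displacement_lipschitz x y pi s : @Iso R k pi ->
  displacement p y pi s <= displacement p x pi s + 2 * config_dist x y.
Proof.
move=> [_ piI].
pose d i := enorm (set_val x i - set_val y i).
pose e i := enorm (set_val x i - pi (set_val x (s i))).
have d0 i : 0 <= d i by exact: enorm_ge0.
have e0 i : 0 <= e i by exact: enorm_ge0.
have -> : displacement p x pi s + 2 * config_dist x y =
    pnorm p d + (pnorm p e + pnorm p (fun i => d (s i))).
  by rewrite pnorm_perm mulr2n mulrDl mul1r [RHS]addrCA.
apply: le_trans _ (lerD (lexx _) (pnormD p1 e0 (fun i => d0 (s i)))).
apply: le_trans _ (pnormD p1 d0 (fun i => addr_ge0 (e0 i) (d0 (s i)))).
apply: le_pnorm => // i; first exact: enorm_ge0.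
rewrite /d -(piI (set_val x (s i))) -(enormN (set_val x i - set_val y i)) opprB.
apply: le_trans _ (lerD (lexx _) (enormD _ _)).
by apply: le_trans _ (enormD _ _); rewrite !addrA !subrK.
Qed.

Lemma symmetry_defect_lipschitz x y : (2 <= n)%N ->
  symmetry_defect p (forget_order y) <=
  symmetry_defect p (forget_order x) + 2 * config_dist x y.
Proof.
move=> n2; apply/ler_addgt0Pr => e e0.
have : symmetry_defect p (forget_order x) < symmetry_defect p (forget_order x) + e.
  by rewrite ltrDl.
case/inf_lt => [|_ [pi piI <-] /(defect_wrt_lt n2 piI)[s s1 sx]].
  by eexists; exists id => //; split=> //; exists id.
have lb : has_lbound [set defect_wrt p (forget_order y) pi | pi in @Iso R k].
  by exists 0 => _ [r _ <-]; exact: powR_ge0.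
apply: le_trans (ge_inf lb (imageP _ piI)) _.
apply: le_trans (defect_wrt_le y piI s1) _.
apply: le_trans (displacement_lipschitz x y s piI) _.
by rewrite addrAC lerD2r.
Qed.

(** * Continuity *)

Lemma near_config_dist x (e : R) : 0 < e ->
  \forall y \near x, config_dist x y <= e.
Proof.
move=> e0.
(* C bounds the l^p distance when all coordinates of all points differ by at
   most 1; it may vanish, hence the C + 1 in the denominators. *)
pose C : R := pnorm p (fun=> pnorm 2 (fun=> 1 : R) (I := 'I_k)) (I := 'I_n).
have C0 : 0 <= C by exact: pnorm_ge0.
have d0 : 0 < e / (C + 1) by rewrite divr_gt0// ltr_wpDl.
have : \forall y \near x, forall i,
    `|set_val x i - set_val y i| < e / (C + 1).
  apply: (@filter_forall _ _ _ (nbhs x) (nbhs_filter x)) => i.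
  have cvg_i : (fun y : oconf R k n => set_val y i) @ x --> set_val x i.
    apply: (@continuous_comp _ _ _
      (set_val : oconf R k n -> {ptws 'I_n -> 'rV[R]_k}) (fun f => f i)).
      exact: initial_continuous.
    exact: proj_continuous.
  by move/cvgr_dist_lt : cvg_i; apply.
apply: filterS => y xy.
apply: (@le_trans _ _ (e / (C + 1) * C)); last first.
  by rewrite mulrAC ler_pdivrMr ?ltr_wpDl// ler_pM2l// lerDl.
rewrite -(pnormZ p1 (ltW d0) (fun=> pnorm_ge0 _ _)).
apply: le_pnorm => // i; first exact: enorm_ge0.
rewrite mulrC; apply: le_trans (enorm_le_norm _) _.
by rewrite ler_wpM2l ?pnorm_ge0// ltW.
Qed.

End Displacement.

(** The projection of a quotient type is locked, so this identification has to
    be stated. *)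
Lemma pi_forget_order (R : realType) (k n : nat) (x : oconf R k n) :
  (\pi_(conf R k n) x)%qT = forget_order x.
Proof. by rewrite unlock. Qed.

Theorem proposition2p3p3 (R : realType) (k n : nat) (p : R)
    (hn : (2 <= n)%N) (hp : 1 <= p) :
  continuous (fun X : conf R k n => symmetry_defect p X : R).
Proof.
apply/(@quotient_continuous _ (conf R k n)) => x.
apply/(@cvgrPdist_le _ _ _ (nbhs x) (nbhs_filter x)) => e e0.
have e20 : 0 < e / 2 by rewrite divr_gt0.
move: (near_config_dist hp x e20).
apply: (@filterS _ (nbhs x) (nbhs_filter x)) => y xy.
have xy2 : 2 * config_dist p x y <= e by rewrite mulrC -ler_pdivlMr.
change (`|symmetry_defect p (\pi_(conf R k n) x)%qT -
  symmetry_defect p (\pi_(conf R k n) y)%qT| <= e).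
rewrite !pi_forget_order ler_distlC lerBlDr; apply/andP; split.
  apply: le_trans (symmetry_defect_lipschitz hp y x hn) _.
  by rewrite config_distC lerD2l.
apply: le_trans (symmetry_defect_lipschitz hp x y hn) _.
by rewrite lerD2l.
Qed.
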